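(* Let $\mathcal H$ be a simple hypergraph without isolated vertices such that, for all vertices $x$ of $\mathcal H$, $\mathcal H:x$ is a graph whose complement is chordal. Then $\operatorname{reg} \mathcal H \le 3$.
   Context: A hypergraph $\mathcal H$ on a finite vertex set $V$ is a collection of subsets of $V$, called edges; it is simple if there are no containments among its edges, and a vertex is isolated if it lies in no edge. A graph is a hypergraph all of whose edges have exactly two vertices. For a vertex $x$ of $\mathcal H$, $\mathcal H:x$ denotes the hypergraph (on $V\setminus\{x\}$) of all sets that are minimal (with respect to inclusion) among the sets of the form $F\cap (V\setminus\{x\})$, where $F$ is an edge of $\mathcal H$. A graph is chordal if it has no induced cycle $C_m$ with $m\ge 4$. Let $k$ be a field and $R=k[V]$ the polynomial ring with variables the vertices of $\mathcal H$; the edge ideal $I(\mathcal H)\subseteq R$ is generated by the monomials $\prod_{x\in F}x$, $F$ an edge of $\mathcal H$. One sets $\operatorname{reg}\mathcal H:=\operatorname{reg} I(\mathcal H)$, where for a finitely generated graded $R$-module $M$ (standard grading, $\mathfrak m$ the ideal generated by all variables) $\operatorname{reg} M := \max\{i+j \mid H^i_{\mathfrak m}(M)_j \neq 0\}$ is the Castelnuovo-Mumford regularity. *)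

(* Defs.v *)
From mathcomp Require Import all_boot all_order all_algebra.
From mathcomp Require Import mpoly.
From mathcomp Require Import constructive_ereal.
(* Not imported: its notations clash with those of [mpoly]. *)
From mathcomp Require classical_sets.

Set Implicit Arguments.
Unset Strict Implicit.
Unset Printing Implicit Defensive.

Import Order.TTheory GRing.Theory Num.Theory.

Local Open Scope ring_scope.

(** * Hypergraphs on the vertex set [V], given by their edge sets *)

Section Hypergraph.
Variable V : finType.
Implicit Types (H G : {set {set V}}) (x u v : V).

Definition simple_hypergraph H : Prop :=
  forall E F, E \in H -> F \in H -> E \subset F -> E = F.

Definition isolated H x : Prop := forall F, F \in H -> x \notin F.

Definition is_graph H : Prop := forall F, F \in H -> #|F| = 2.

(* [val @^-1: F] is F :&: (V \ {x}), seen as a subset of V \ {x}. *)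
Definition traces H x : {set {set {y : V | y != x}}} :=
  [set (val @^-1: F : {set {y : V | y != x}}) | F : {set V} in H].

(* The hypergraph H : x. *)
Definition hlink H x : {set {set {y : V | y != x}}} :=
  [set A | minset (mem (traces H x)) A].

Definition graph_compl G : {set {set V}} :=
  [set F : {set V} | (#|F| == 2) && (F \notin G)].

(* The cyclic sequence [s] of distinct vertices spans an induced cycle;
   only meant for [size s >= 3]. *)
Definition induced_cycle G (s : seq V) : Prop :=
  uniq s /\ {in s &, forall u v,
    ([set u; v] \in G) = (v == next s u) || (u == next s v)}.

Definition chordal G : Prop :=
  forall s : seq V, (4 <= size s)%N -> ~ induced_cycle G s.

End Hypergraph.

(** * Local cohomology and regularity of ideals *)

Section Regularity.
Variables (k : fieldType) (n : nat).
Implicit Types (I : {mpoly k[n]} -> Prop) (i j : int) (S T : {set 'I_n}).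

Local Notation Frac := {fraction {mpoly k[n]}}.

(* The degree is an integer and 0 is homogeneous of every degree, negative
   degrees included. *)
Definition zhomog (j : int) (f : {mpoly k[n]}) : Prop :=
  forall m, m \in msupp f -> (mdeg m)%:Z = j.

(* The degree [j] part of the localization of the ideal [I] at the product
   x_S of the variables indexed by [S]. As the polynomial ring is a domain,
   this localization is the set of the fractions f / x_S^t, with f in [I],
   inside the fraction field. *)
Definition loc_deg I S j (u : Frac) : Prop :=
  exists (f : {mpoly k[n]}) (t : nat),
    [/\ I f, zhomog (j + (t * #|S|)%:Z) f
      & u = tofrac f / tofrac (\prod_(a in S) 'X_a) ^+ t].

(* Degree [j] part of the [i]-th term, the direct sum of the I_{x_S} over
   #|S| = i, of the Cech complex of the graded module [I] with respect to the
   variables; this term is 0 for [i] < 0 or [i] > n. *)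
Definition cech_cochain I i j (c : {set 'I_n} -> Frac) : Prop :=
  forall S, if #|S|%:Z == i then loc_deg I S j (c S) else c S = 0.

Definition cech_diff (c : {set 'I_n} -> Frac) : {set 'I_n} -> Frac :=
  fun T => \sum_(a in T) (-1) ^+ #|[set b in T | (b < a)%N]| * c (T :\ a).

(* H^i_m(I)_j <> 0, where H^i_m(I) is the i-th cohomology of the Cech
   complex: there is a cocycle that is not a coboundary. *)
Definition local_cohomology_neq0 I i j : Prop :=
  exists c, [/\ cech_cochain I i j c, (forall T, cech_diff c T = 0)
    & ~ exists b, cech_cochain I (i - 1) j b /\ forall T, cech_diff b T = c T].

(* The supremum in Z with -oo and +oo adjoined: it is the maximum when there is
   one, and -oo when all the local cohomology vanishes (I = 0). *)
Definition reg I : \bar int :=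
  classical_sets.supremum -oo%E
    (fun r => exists i j : int,
       local_cohomology_neq0 I i j /\ r = (i + j)%:E).

End Regularity.

(** * Edge ideals; the variables are indexed by the enumeration of [V] *)

Section EdgeIdeal.
Variables (k : fieldType) (V : finType) (H : {set {set V}}).

Definition edge_monomial (F : {set V}) : {mpoly k[#|V|]} :=
  \prod_(x in F) 'X_(enum_rank x).

Definition edge_ideal (f : {mpoly k[#|V|]}) : Prop :=
  exists c : {set V} -> {mpoly k[#|V|]}, f = \sum_(F in H) c F * edge_monomial F.

Definition hreg : \bar int := reg edge_ideal.

End EdgeIdeal.

(* Main.v *)
Require Import Defs.
From mathcomp Require Import all_boot all_order all_algebra.
From mathcomp Require Import mpoly.
From mathcomp Require Import constructive_ereal.
From mathcomp Require classical_sets.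
From mathcomp Require Import zify.
From mathcomp Require boolp.

(** A bound [reg <= 3] says that every cocycle of the Cech complex of the edge
    ideal in cohomological degree [i] and internal degree [j] with [4 <= i + j]
    is a coboundary ([cech_coboundary]). The complex is graded by Laurent
    exponents: after clearing denominators, each monomial [m] gives a complex of
    scalar cochains on the sets [S] that contain the set [N] of the negative
    entries of the exponent and for which [S], together with the set [P] of its
    positive entries, contains an edge. If [P] is nonempty this complex is a
    cone. If [P] is empty then [j <= - #|N|], and it must be shown that the
    sets above [N] that contain an edge carry no cohomology in degrees
    [i >= #|N| + 4] ([acyclic_contains_edge]); in topological terms, that the
    link of [N] in the independence complex of the hypergraph has no reduced
    cohomology in degrees at least 2, and none in degree 1 either if [N] is
    nonempty.

    The hypotheses force all edges to have three elements ([card_edge]), and a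
    set that contains [x] contains an edge exactly if it contains one through
    [x] ([contains_edge_triple]). So the link of a vertex [x] in the
    independence complex is the clique complex of the complement of the graph
    [H : x], which is chordal. By Dirac's theorem ([exists_simplicial]) such a
    complex can be taken apart by deleting simplicial vertices, whose links are
    simplices; this gives the vanishing in degrees at least 1 when [N] is
    nonempty ([acyclic_above_vertex]). For empty [N], all vertices are deleted
    one by one: the long exact sequence of each deletion involves the link of the
    deleted vertex, which has no cohomology in the relevant degrees
    ([acyclic_above]). *)

Set Implicit Arguments.
Unset Strict Implicit.
Unset Printing Implicit Defensive.
Import Order.TTheory GRing.Theory Num.Theory.

(** * Cochains on families of subsets *)

Section Cochains.
Variables (R : nzRingType) (n : nat).
Implicit Types (A B S T : {set 'I_n}) (a b x : 'I_n) (i : int).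
Implicit Types (c d : {set 'I_n} -> R).
Local Open Scope ring_scope.

Definition position T (a : 'I_n) := #|[set b in T | (b < a)%N]|.

Definition coboundary c T : R :=
  \sum_(a in T) (-1) ^+ position T a * c (T :\ a).

Lemma position_lt T a b : (b < a)%N -> position (T :\ a) b = position T b.
Proof.
move=> lt_ba; apply: eq_card => z; rewrite !inE.
by case: eqP => //= ->; rewrite ltnNge (ltnW lt_ba) andbF.
Qed.

Lemma position_gt T a b :
  a \in T -> (a < b)%N -> position T b = (position (T :\ a) b).+1.
Proof.
move=> aT lt_ab; rewrite /position (cardsD1 a) inE aT lt_ab add1n.
by congr _.+1; apply: eq_card => z; rewrite !inE andbA.
Qed.

(** The two ways of removing a pair of elements carry opposite signs, because
    removing the smaller one first shifts the position of the larger one. *)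
Lemma coboundary_swap c T a b : a \in T -> b \in T -> (a < b)%N ->
  (-1) ^+ position T b * ((-1) ^+ position (T :\ b) a * c (T :\ b :\ a)) =
  - ((-1) ^+ position T a * ((-1) ^+ position (T :\ a) b * c (T :\ a :\ b))).
Proof.
move=> aT bT lt_ab; rewrite (position_lt T lt_ab) (position_gt aT lt_ab).
have -> : T :\ b :\ a = T :\ a :\ b by apply/setP => z; rewrite !inE andbCA.
by rewrite !mulrA -!exprD addSn exprS mulN1r mulNr addnC.
Qed.

Lemma coboundaryK c T : coboundary (coboundary c) T = 0.
Proof.
pose G a b : R :=
  (-1) ^+ position T a * ((-1) ^+ position (T :\ a) b * c (T :\ a :\ b)).
have -> : coboundary (coboundary c) T =
    \sum_(a in T) (\sum_(b in T | (a < b)%N) G a b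
                   + \sum_(b in T | (b < a)%N) G a b).
  apply: eq_bigr => a _; rewrite mulr_sumr (bigID (fun b : 'I_n => (a < b)%N)) /=.
  by congr (_ + _); apply: eq_bigl => b; rewrite !inE -val_eqE /=;
    case: (b \in T) => //=; lia.
(* Exchanging the two sums in the second half pairs each (a, b) with (b, a);
   cancelling pairs rather than halving keeps characteristic 2 in range. *)
rewrite big_split /= [X in _ + X](exchange_big_dep (fun b => b \in T)) /=;
  last by move=> a b _ /andP[].
rewrite -big_split /= big1 // => a aT.
rewrite aT -big_split big1 //= => b /andP[bT lt_ab].
by rewrite /G (coboundary_swap c aT bT lt_ab) subrr.
Qed.

Lemma eq_coboundary c d T :
  {in T, forall a, c (T :\ a) = d (T :\ a)} -> coboundary c T = coboundary d T.
Proof. by move=> cb; apply: eq_bigr => a /cb ->. Qed.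

Lemma coboundaryD c d T :
  coboundary (fun S => c S + d S) T = coboundary c T + coboundary d T.
Proof. by rewrite -big_split; apply: eq_bigr => a _; rewrite mulrDr. Qed.

Lemma coboundaryB c d T :
  coboundary (fun S => c S - d S) T = coboundary c T - coboundary d T.
Proof. by rewrite -sumrB; apply: eq_bigr => a _; rewrite mulrBr. Qed.

Lemma coboundary_neq0 c T :
  coboundary c T != 0 -> exists2 a, a \in T & c (T :\ a) != 0.
Proof.
move=> dcT; apply/exists_inP; apply: contraR dcT => /exists_inPn c0.
by rewrite /coboundary big1 // => a /c0/negPn/eqP ->; rewrite mulr0.
Qed.

Lemma coboundary_eq0 c T : (forall S, c S = 0) -> coboundary c T = 0.
Proof. by move=> c0; apply: big1 => a _; rewrite c0 mulr0. Qed.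

Lemma coboundary_avoiding c T x :
    x \in T -> (forall S, x \in S -> S \subset T -> c S = 0) ->
  coboundary c T = (-1) ^+ position T x * c (T :\ x).
Proof.
move=> xT c0; rewrite /coboundary (bigD1 x) //= big1 ?addr0 // => a /andP[_ ax].
by rewrite c0 ?mulr0 ?subsetDl // !inE eq_sym ax.
Qed.

Definition supported A B (U : pred {set 'I_n}) i c :=
  forall S, c S != 0 -> [/\ A \subset S, S \subset B, U S & #|S|%:Z = i].

(** This is the vanishing of the degree [i] cohomology of the complex spanned by
    the members of [U] between [A] and [B]. For an upward closed [U] these
    cochains are stable under the coboundary, and a coboundary is zero at the
    sets that do not contain [A], so that only [T \subset B] is tested. *)
Definition acyclic A B (U : pred {set 'I_n}) i :=
  forall c, supported A B U i c ->
    (forall T, T \subset B -> coboundary c T = 0) ->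
  exists2 b, supported A B U (i - 1) b
           & forall T, T \subset B -> coboundary b T = c T.

Definition upward_closed (U : pred {set 'I_n}) :=
  forall S T, S \subset T -> U S -> U T.

Lemma acyclic_void A B (U : pred {set 'I_n}) i :
    (forall S, A \subset S -> S \subset B -> U S -> #|S|%:Z = i -> False) ->
  acyclic A B U i.
Proof.
move=> void c csupp _; have c0 S : c S = 0.
  by apply/eqP; apply: contraPT isT => /csupp[AS SB US /(void _ AS SB US)].
exists (fun=> 0) => [S|T _]; first by rewrite eqxx.
by rewrite coboundary_eq0 // c0.
Qed.

(** Removing or adding [x] matches the sets of the complex in pairs, and sending
    [c] to [S |-> c (x |: S)], up to sign, is a contracting homotopy. *)
Lemma acyclic_cone A B (U : pred {set 'I_n}) i x :
    x \in B -> x \notin A ->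
    (forall S, A \subset S -> S \subset B -> U S = U (x |: S)) ->
  acyclic A B U i.
Proof.
move=> xB xA Ux c csupp ccl.
pose b S := if x \in S then 0 else (-1) ^+ position (x |: S) x * c (x |: S).
have b0 S : x \in S -> b S = 0 by rewrite /b => ->.
have db T : x \in T -> coboundary b T = c T.
  move=> xT; rewrite (coboundary_avoiding xT) => [|S xS _]; last exact: b0.
  by rewrite /b setD11 setD1K // mulrA -exprD addnn -signr_odd odd_double mul1r.
exists b => [S|T TB].
  rewrite /b; case: ifP => [_|xS]; first by rewrite eqxx.
  move=> sc0; have: c (x |: S) != 0.
    by apply: contraNneq sc0 => ->; rewrite mulr0.
  move=> /csupp[AxS xSB UxS cardS].
  have AS : A \subset S by rewrite -(setU1K (negbT xS)) subsetD1 AxS xA.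
  have SB : S \subset B by apply: subset_trans xSB; apply: subsetUr.
  by split=> //; [rewrite Ux|move: cardS; rewrite cardsU1 xS; lia].
(* The cocycle [coboundary b - c] lives on the sets that avoid [x]; at [x |: T]
   its coboundary has a single term, its value at [T]. *)
have [/db//|xT] := boolP (x \in T).
have xTB : x |: T \subset B by rewrite subUset sub1set xB.
have: coboundary (fun S => coboundary b S - c S) (x |: T) = 0.
  by rewrite coboundaryB coboundaryK ccl // subrr.
rewrite (coboundary_avoiding (setU11 _ _)) => [|S xS _]; last by rewrite db ?subrr.
rewrite setU1K // => /(congr1 (fun r => (-1) ^+ position (x |: T) x * r)).
rewrite mulrA -exprD addnn -signr_odd odd_double mul1r mulr0.
by move/eqP; rewrite subr_eq0 => /eqP.
Qed.

(** The sets that contain [x] span a subcomplex, whose quotient is spanned by the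
    sets that avoid [x]: this is the piece of the long exact sequence that
    compares the complex with a link and a deletion. *)
Lemma acyclic_split A B (U : pred {set 'I_n}) i x :
    upward_closed U -> x \in B -> x \notin A ->
  acyclic (x |: A) B U i -> acyclic A (B :\ x) U i -> acyclic A B U i.
Proof.
move=> Uup xB xA acyc_with acyc_without c csupp ccl.
have [||b' b'supp db'] := acyc_without (fun S => if x \in S then 0 else c S).
- move=> S; case: ifP => [_|xS]; first by rewrite eqxx.
  by move=> /csupp[AS SB US cardS]; split=> //; rewrite subsetD1 SB xS.
- move=> T; rewrite subsetD1 => /andP[TB xT]; rewrite -[RHS](ccl T TB).
  by apply: eq_coboundary => a _; rewrite !inE (negPf xT) andbF.
pose c' S := if S \subset B then c S - coboundary b' S else 0.
have [||b'' b''supp db''] := acyc_with c'.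
- move=> S; rewrite /c'; case: ifP => [SB|]; last by rewrite eqxx.
  have [xS|xS] := boolP (x \in S); last first.
    by rewrite db' ?subsetD1 ?SB // (negPf xS) subrr eqxx.
  rewrite subUset sub1set xS /= => cb0.
  have [c0|/csupp[AS _ US cardS]] := eqVneq (c S) 0; last by split.
  move: cb0; rewrite c0 sub0r oppr_eq0.
  move=> /coboundary_neq0[a aS /b'supp[AS _ US cardS]].
  split=> //; last by move: cardS; rewrite [in #|S|](cardsD1 a) aS; lia.
    exact: subset_trans AS (subsetDl _ _).
  by apply: Uup US; apply: subsetDl.
- move=> T TB; rewrite -[RHS](subrr (coboundary c T)) {2}ccl //.
  rewrite -(coboundaryK b' T) -coboundaryB; apply: eq_coboundary => a _.
  by rewrite /c' (subset_trans (subsetDl _ _) TB).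
exists (fun S => b' S + b'' S) => [S bS|T TB]; last first.
  by rewrite coboundaryD db'' // /c' TB addrC subrK.
have [b'0|/b'supp[AS]] := eqVneq (b' S) 0; last first.
  by rewrite subsetD1 => /andP[].
move: bS; rewrite b'0 add0r => /b''supp[]; rewrite subUset => /andP[_ AS] SB US.
by split.
Qed.

(** If [A] is in [U] the complex is that of all sets between [A] and [B]: a cone,
    or the single set [A] if [A = B]. *)
Lemma acyclic_full A B (U : pred {set 'I_n}) i :
  upward_closed U -> U A -> #|A|%:Z < i -> acyclic A B U i.
Proof.
move=> Uup UA lt_Ai; have [x /andP[xB xA]|sBA] := pickP [pred x in B | x \notin A].
  apply: (acyclic_cone xB xA) => S AS SB.
  by rewrite (Uup _ _ AS UA) (Uup _ _ (subset_trans AS (subsetUr _ _)) UA).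
apply: acyclic_void => S _ SB _ cardS.
have BA : B \subset A.
  by apply/subsetP => z zB; apply: contraFT (sBA z); rewrite /= zB.
by move: lt_Ai (subset_leq_card (subset_trans SB BA)); rewrite -cardS; lia.
Qed.

(** An element [z] of [B] for which [z |: A] is in [U] can be deleted, because its
    link is a full interval. What is left after deleting all of them spans the
    zero complex as soon as it is not in [U]. In terms of clique complexes: the
    common neighbourhood of [A] is a simplex. *)
Lemma acyclic_prune A B (U : pred {set 'I_n}) i :
    upward_closed U -> #|A|%:Z + 2 <= i ->
    ~~ U (A :|: [set z in B | ~~ U (z |: A)]) ->
  acyclic A B U i.
Proof.
move=> Uup le_Ai; have [m] := ubnP #|B|; elim: m B => // m IHm B leBm UB0.
have [z /and3P[zB zA UzA]|noz] :=
    pickP [pred z | [&& z \in B, z \notin A & U (z |: A)]].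
  apply: (acyclic_split Uup zB zA).
    by apply: acyclic_full => //; rewrite cardsU1 zA; lia.
  have ltBm : (#|B :\ z| < m)%N by move: leBm; rewrite (cardsD1 z B) zB; lia.
  apply: (IHm _ ltBm); apply: contra UB0; apply: Uup; apply: setUS.
  by apply/subsetP => y; rewrite !inE => /andP[/andP[_ ->]].
apply: acyclic_void => S _ SB US _; case/negP: UB0; apply: Uup US.
apply/subsetP => z zS; rewrite !inE; have zB := subsetP SB z zS.
by move: (noz z); rewrite /= zB /=; case: (z \in A) => //= ->.
Qed.

End Cochains.

(** * Simplicial vertices of chordal graphs *)

Section ShortestPath.
Variables (T : finType) (e : rel T) (a b : T).

Lemma shortest_path : connect e a b ->
  exists p, [/\ path e a p, last a p = b
    & forall q, path e a q -> last a q = b -> (size p <= size q)%N].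
Proof.
move=> /connectP[p0 p0_path p0_last].
pose walk m := [exists t : m.-tuple T, path e a t && (last a t == b)].
have walkP q : path e a q -> last a q = b -> walk (size q).
  by move=> qp ql; apply/existsP; exists (in_tuple q); rewrite /= qp ql eqxx.
have ex_walk : exists m, walk m by exists (size p0); apply: walkP.
case: (ex_minnP ex_walk) => m /existsP[p /andP[pp /eqP pl]] min_m.
by exists p; split=> // q qp ql; rewrite size_tuple; apply/min_m/walkP.
Qed.

Variable p : seq T.
Hypotheses (p_path : path e a p) (p_last : last a p = b).
Hypothesis p_min :
  forall q, path e a q -> last a q = b -> (size p <= size q)%N.

Lemma last_take_nth i : (i <= size p)%N -> last a (take i p) = nth a (a :: p) i.
Proof.
case: i => [|i] lt_ip; first by rewrite take0.
by rewrite (take_nth a lt_ip) last_rcons.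
Qed.

Lemma shortest_path_uniq i j : (i < j <= size p)%N ->
  nth a (a :: p) i != nth a (a :: p) j.
Proof.
move=> /andP[lt_ij le_jp]; apply/eqP => eq_ij.
have le_ip : (i <= size p)%N by apply: leq_trans le_jp; apply: ltnW.
have: (size p <= size (take i p ++ drop j p))%N.
  move: p_path p_last; rewrite -{1 2}(cat_take_drop j p) cat_path last_cat.
  rewrite last_take_nth // => /andP[_ path_j] last_j.
  apply: p_min; rewrite ?cat_path ?last_cat last_take_nth // eq_ij //.
  by rewrite path_j take_path.
rewrite size_cat size_take size_drop; case: ifP; lia.
Qed.

(** A chord would give a strictly shorter path from [a] to [b]. *)
Lemma shortest_path_chordless i j : (i < j <= size p)%N ->
  e (nth a (a :: p) i) (nth a (a :: p) j) = (j == i.+1).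
Proof.
case: j => // j /andP[lt_ij lt_jp].
have le_ip : (i <= size p)%N by lia.
apply/idP/eqP => [e_ij|[->]]; last by apply: (pathP a p_path); lia.
have: (size p <= size (take i p ++ drop j p))%N.
  move: p_path p_last; rewrite -{1 2}(cat_take_drop j p) cat_path last_cat.
  rewrite last_take_nth; last exact: ltnW.
  rewrite (drop_nth a lt_jp) /= => /and3P[_ _ path_j] last_j.
  apply: p_min; rewrite ?cat_path ?last_cat last_take_nth //=.
  by rewrite path_j e_ij take_path.
rewrite size_cat size_take size_drop; case: ifP; lia.
Qed.

End ShortestPath.

Section ChordalGraph.
Variables (T : finType) (G : {set {set T}}).
Hypotheses (G_graph : is_graph G) (G_chordal : chordal G).
Implicit Types (u v w y z : T) (W C D S : {set T}).

Definition adj : rel T := [rel u v | [set u; v] \in G].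

Lemma adjC u v : adj u v = adj v u. Proof. by rewrite /adj /= setUC. Qed.

Lemma adjxx u : adj u u = false.
Proof. by apply/negP => /G_graph; rewrite setUid cards1. Qed.

Definition simplicial W y :=
  {in W &, forall u w, u != w -> adj y u -> adj y w -> adj u w}.

(** A shortest path from [a] to [b] with inner vertices in [D] has no chord, and [v]
    is adjacent only to its ends; if [a] and [b] were not adjacent, [v] would
    close it up to an induced cycle with at least four vertices. *)
Lemma adj_of_detour v a b D :
    adj v a -> adj v b -> a != b -> {in D, forall z, z != v /\ ~~ adj v z} ->
    connect [rel x y | [&& adj x y, x \in a |: (b |: D) & y \in a |: (b |: D)]]
      a b ->
  adj a b.
Proof.
set e := [rel x y | _] => va vb ab Dv /shortest_path[p [p_path p_last p_min]].
apply: contraT => nab.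
have uniq_q := shortest_path_uniq p_path p_last p_min.
have chord_q := shortest_path_chordless p_path p_last p_min.
set q := a :: p in uniq_q chord_q *.
have q_last : nth a q (size p) = b by rewrite -p_last (last_nth a).
have q_in i : (i <= size p)%N -> nth a q i \in a |: (b |: D).
  case: i => [|i] ip; first by rewrite setU11.
  by have /and3P[] := pathP a p_path i ip.
have adj_q i j : (i < j <= size p)%N -> adj (nth a q i) (nth a q j) = (j == i.+1).
  move=> ijp; rewrite -chord_q //= !q_in ?andbT //; lia.
have q_int i : (0 < i < size p)%N -> nth a q i \in D.
  move=> ip; have: (i <= size p)%N by lia.
  move/q_in; rewrite !inE => /or3P[/eqP qa|/eqP qb|//].
    by have := uniq_q 0 i; rewrite /= qa eqxx; lia.
  by have := uniq_q i (size p); rewrite q_last qb eqxx; lia.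
have p_gt1 : (1 < size p)%N.
  have := q_last; case sp: (size p) => [|[|]] //= pb.
    by case/eqP: ab.
  by have := adj_q 0 1; rewrite sp /= pb (negPf nab) => /(_ isT).
have adj_vq i : (i <= size p)%N -> adj v (nth a q i) = (i == 0) || (i == size p).
  case: i => [|i] ip; first by rewrite /= va.
  have [->|ne_ip] := eqVneq i.+1 (size p); first by rewrite q_last vb orbT.
  by apply/negbTE; have [|_ //] := Dv (nth a q i.+1); apply: q_int; lia.
have q_neqv i : (i <= size p)%N -> nth a q i != v.
  move=> ip; have [i0|i0] := boolP ((i == 0) || (i == size p)).
    by move: i0; rewrite -adj_vq //; apply: contraTneq => ->; rewrite adjxx.
  by have [|//] := Dv (nth a q i); apply: q_int; move: i0; lia.
have nth_vq i : (i <= size p)%N -> nth v q i = nth a q i.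
  by move=> ip; apply: set_nth_default.
have s_uniq : uniq (v :: q).
  rewrite cons_uniq; apply/andP; split.
    by apply/(nthP a) => -[i ip /eqP]; rewrite (negPf (q_neqv _ _)).
  apply/(uniqP a) => i j ip jp; case: (ltngtP i j) => // lt_ij /eqP.
    by rewrite (negPf (uniq_q _ _ _)) //; move: jp; rewrite inE /=; lia.
  by rewrite eq_sym (negPf (uniq_q _ _ _)) //; move: ip; rewrite inE /=; lia.
have next_s i : (i <= size q)%N -> next (v :: q) (nth v (v :: q) i) = nth v q i.
  by move=> iq; rewrite next_nth mem_nth // index_uniq.
case: (G_chordal (s := v :: q)) => //; split=> // u w.
move=> /(nthP v)[i iq <-] /(nthP v)[j jq <-]; rewrite !next_s //.
(* The default value [v] of [nth] makes the successor of the last entry of [q]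
   the first vertex [v] of the cycle. *)
have eq_next l m : (l <= size q)%N -> (m <= size q)%N ->
  (nth v (v :: q) m == nth v q l) = if l == size q then m == 0 else m == l.+1.
  move=> lq mq; have [->|ne_lq] := eqVneq l (size q).
    rewrite (nth_default v (leqnn _)) -[X in _ == X]/(nth v (v :: q) 0).
    by rewrite nth_uniq.
  rewrite -[nth v q l]/(nth v (v :: q) l.+1) nth_uniq //.
  by rewrite ltnS ltn_neqAle ne_lq.
have size_q : size q = (size p).+1 by [].
rewrite !eq_next // !size_q -[_ \in G]/(adj _ _).
wlog lt_ij: i j iq jq / (i <= j)%N => [wl|].
  have [/wl->//|lt_ji] := leqP i j.
  by rewrite adjC orbC; apply: wl => //; apply: ltnW.
case: (eqVneq i j) lt_ij => [<- _|ne_ij]; first by rewrite adjxx; case: ifP; lia.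
case: i j iq jq ne_ij => [|i] [|j] //= iq jq ne_ij lt_ij.
  by rewrite nth_vq ?adj_vq //; do 2?case: ifP; lia.
by rewrite !nth_vq ?adj_q //; do 2?case: ifP; lia.
Qed.

(** This is Dirac's theorem in a form suited to induction. Let [C] be a connected
    component of what remains of [W] without [v] and its neighbours, and [S] the
    set of the vertices outside [C] with a neighbour in [C]. Then [S] lies in the
    neighbourhood of [v] and is a clique by [adj_of_detour], and a vertex of [C]
    that is simplicial in [C :|: S] is simplicial in [W]. Such a vertex exists:
    either [C :|: S] is a clique, or the induction hypothesis applies to it and
    to a vertex of [S], or else of [C], that is not adjacent to all others. *)
Lemma simplicial_avoiding W v w :
    v \in W -> w \in W -> w != v -> ~~ adj v w ->
  exists y, [/\ y \in W, y != v, ~~ adj v y & simplicial W y].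
Proof.
have [m] := ubnP #|W|; elim: m W v w => // m IHm W v w leWm vW wW wv nvw.
pose D := [set z in W | (z != v) && ~~ adj v z].
pose r := [rel x y | [&& adj x y, x \in D & y \in D]].
have r_sym : ssrbool.symmetric r by move=> x y; rewrite [LHS]/= adjC [X in _ && X]andbC.
pose C := [set z | connect r w z].
pose S := [set s in W :\: C | [exists c in C, adj s c]].
have wD : w \in D by rewrite inE wW wv.
have wC : w \in C by rewrite inE connect0.
have subCD : C \subset D.
  apply/subsetP => z; rewrite inE => /connectP[p pp ->].
  by case/lastP: p pp => //= p y; rewrite rcons_path last_rcons => /and4P[].
have nbrC c u : c \in C -> u \in W -> adj c u -> u \in C :|: S.
  move=> cC uW cu; rewrite !inE uW andbT; case: (connect r w u) => //=.
  by apply/existsP; exists c; rewrite adjC cu cC.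
have SN s : s \in S -> adj v s.
  rewrite !inE => /andP[/andP[sC sW] /existsP[c /andP[cC sc]]].
  apply: contraR sC => nvs.
  apply: (connect_trans (y := c)); first by rewrite inE in cC.
  have cD := subsetP subCD c cC.
  apply: connect1; rewrite /= adjC sc cD inE sW nvs /= andbT.
  by apply: contraTneq sc => ->; move: cD; rewrite inE => /and3P[].
have S_clique : {in S &, forall s t, s != t -> adj s t}.
  move=> s t sS tS st.
  apply: (adj_of_detour (v := v) (D := D)) => //; try exact: SN.
    by move=> z; rewrite inE => /and3P[_ ? ?].
  set e := [rel x y | _].
  have sub_re : subrel (connect r) (connect e).
    apply: connect_sub => x y /and3P[xy xD yD]; apply: connect1.
    by rewrite /= xy !in_setU xD yD !orbT.
  move: sS tS; rewrite !inE => /andP[_ /existsP[c /andP[cC sc]]].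
  move=> /andP[_ /existsP[d /andP[dC td]]].
  have [cD dD] := (subsetP subCD c cC, subsetP subCD d dC).
  apply: (connect_trans (y := c)).
    by apply: connect1; rewrite /= sc !in_setU set11 cD !orbT.
  apply: (connect_trans (y := d)); last first.
    by apply: connect1; rewrite /= adjC td !in_setU set11 dD !orbT.
  apply: sub_re; apply: (connect_trans (y := w)).
    by rewrite (sym_connect_sym r_sym); rewrite inE in cC.
  by rewrite inE in dC.
have subCSW : C :|: S \subset W :\ v.
  apply/subsetP => z; rewrite inE => /orP[/(subsetP subCD)|zS].
    by rewrite !inE => /and3P[-> ->].
  have := SN z zS; move: zS; rewrite 3!inE => /andP[/andP[_ zW] _] vz.
  by rewrite !inE zW andbT; apply: contraTneq vz => ->; rewrite adjxx.
have ltCSm : (#|C :|: S| < m)%N.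
  by have := subset_leq_card subCSW; move: leWm; rewrite (cardsD1 v W) vW; lia.
suff [y yC y_simp] : exists2 y, y \in C & simplicial (C :|: S) y.
  have /(subsetP subCD) := yC; rewrite inE => /and3P[yW yv nvy].
  exists y; split=> // u z uW zW uz yu yz.
  by apply: y_simp => //; apply: nbrC yC _ _.
have [s /andP[sS /exists_inP[z zCS /andP[zs nsz]]]|Suniv] :=
    pickP [pred s | (s \in S) && [exists z in C :|: S, (z != s) && ~~ adj s z]].
  have [|y [yCS ys nsy y_simp]] := IHm _ s z ltCSm _ zCS zs nsz.
    by rewrite inE sS orbT.
  exists y => //; move: yCS; rewrite inE => /orP[//|yS].
  by rewrite S_clique // eq_sym in nsy.
have [c /andP[cC /exists_inP[z zCS /andP[zc ncz]]]|Cuniv] :=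
    pickP [pred c | (c \in C) && [exists z in C :|: S, (z != c) && ~~ adj c z]].
  have cCS : c \in C :|: S by rewrite inE cC.
  have [y [yCS yc ncy y_simp]] := IHm _ c z ltCSm cCS zCS zc ncz.
  exists y => //; move: yCS; rewrite inE => /orP[//|yS].
  have := Suniv y; rewrite /= yS => /exists_inP[]; exists c => //.
  by rewrite eq_sym yc adjC.
exists w => // u z uCS zCS uz _ _; apply: contraT => nuz.
have [uC|uS] := setUP uCS.
  have := Cuniv u; rewrite /= uC => /exists_inP[]; exists z => //.
  by rewrite eq_sym uz.
have := Suniv u; rewrite /= uS => /exists_inP[]; exists z => //.
by rewrite eq_sym uz.
Qed.

Lemma exists_simplicial W x : x \in W -> exists2 y, y \in W & simplicial W y.
Proof.
move=> xW; have [v /andP[vW /exists_inP[w wW /andP[wv nvw]]]|Wuniv] :=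
    pickP [pred v | (v \in W) && [exists w in W, (w != v) && ~~ adj v w]].
  by have [y [yW _ _ y_simp]] := simplicial_avoiding vW wW wv nvw; exists y.
exists x => // u w uW wW uw _ _; apply: contraT => nuw.
have := Wuniv u; rewrite /= uW => /exists_inP[]; exists w => //.
by rewrite eq_sym uw.
Qed.

End ChordalGraph.

(** * Families of sets with chordal links *)

Section Induction.
(* [U S] stands for: [S] contains an edge, and [tri x] for the adjacency in the
   link of [x]; a simplicial vertex in [tri_simplicial] is simplicial in the
   complement of that link. *)
Variables (R : nzRingType) (n : nat) (U : pred {set 'I_n}).
Variable tri : 'I_n -> 'I_n -> 'I_n -> bool.
Implicit Types (A B S W : {set 'I_n}) (u w x y : 'I_n) (i : int).
Hypothesis U_upward : upward_closed U.
Hypothesis U_tri : forall x S, x \in S ->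
  U S = [exists u in S, exists w in S, tri x u w].
Hypothesis tri_simplicial : forall x W z, x \notin W -> z \in W ->
  exists2 y, y \in W & {in W &, forall u w,
    tri x u w -> tri x y u || tri x y w}.
Hypothesis triC : forall x u w, tri x u w = tri x w u.
Local Open Scope ring_scope.

(** This is the easy half of Froeberg's theorem: links in the clique complex of a
    chordal graph have no reduced cohomology in positive degrees. Delete the
    elements of [B] that are not adjacent to all of [A], then repeatedly a vertex
    that is simplicial in what is left: its link is a simplex, which is the case
    of [acyclic_prune]. *)
Lemma acyclic_above_vertex A B i x :
  x \in A -> #|A|%:Z + 3 <= i -> acyclic R A B U i.
Proof.
move=> xA le_Ai; have [m] := ubnP #|B|; elim: m B => // m IHm B leBm.
have [UA|nUA] := boolP (U A); first by apply: acyclic_full => //; lia.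
have IH y : y \in B -> acyclic R A (B :\ y) U i.
  move=> yB.
  have ltBm : (#|B :\ y| < m)%N by move: leBm; rewrite (cardsD1 y B) yB.
  exact: IHm ltBm.
have [y /and3P[yB yA UyA]|noy] :=
    pickP [pred y | [&& y \in B, y \notin A & U (y |: A)]].
  apply: (acyclic_split U_upward yB yA (acyclic_full U_upward UyA _) (IH y yB)).
  by rewrite cardsU1 yA; lia.
have [BA0|[z zBA]] := set_0Vmem (B :\: A).
  apply: acyclic_void => S _ SB _ cardS.
  have BA : B \subset A by rewrite -setD_eq0 BA0.
  by have := subset_leq_card (subset_trans SB BA); lia.
have xBA : x \notin B :\: A by rewrite inE xA.
have [y yBA y_simp] := tri_simplicial xBA zBA.
have [yA yB] := setDP yBA.
apply: (acyclic_split U_upward yA yB _ (IH y yA)).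
apply: acyclic_prune => //; first by rewrite cardsU1 yB; lia.
(* The elements of [N] outside [y |: A] are the neighbours of [y] in what is left
   of [B]; as [y] is simplicial, they span a clique together with [y |: A]. *)
set N := [set v in B | _].
have xyA : x \in y |: A by rewrite inE xA orbT.
have nUyA : ~~ U (y |: A) by have /negbT := noy y; rewrite /= yA yB.
have N_pair u w : u \in y |: A -> w \in N -> ~~ tri x u w.
  move=> uyA; rewrite inE => /andP[_]; apply: contra => xuw.
  rewrite (U_tri (x := x)) ?inE ?xA ?orbT //.
  apply/exists_inP; exists u; first by rewrite in_setU1 uyA orbT.
  by apply/exists_inP; exists w; rewrite ?setU11.
rewrite (U_tri (x := x)) ?inE ?xA ?orbT //.
apply/exists_inP => -[u uyAN /exists_inP[w wyAN xuw]].
have N_BA v : v \in N -> v \notin y |: A -> v \in B :\: A.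
  by rewrite inE => /andP[vB _]; rewrite inE negb_or => /andP[_ vA]; rewrite inE vA.
have [uyA|uyA] := boolP (u \in y |: A).
  have [wyA|wyA] := boolP (w \in y |: A).
    case/negP: nUyA; rewrite (U_tri xyA).
    by apply/exists_inP; exists u => //; apply/exists_inP; exists w.
  have wN : w \in N by move: wyAN; rewrite inE (negPf wyA).
  by rewrite (negPf (N_pair u w uyA wN)) in xuw.
have uN : u \in N by move: uyAN; rewrite inE (negPf uyA).
have [wyA|wyA] := boolP (w \in y |: A).
  by rewrite triC (negPf (N_pair w u wyA uN)) in xuw.
have wN : w \in N by move: wyAN; rewrite inE (negPf wyA).
have /orP[] := y_simp u w (N_BA u uN uyA) (N_BA w wN wyA) xuw; apply/negP.
  by apply: N_pair; rewrite ?setU11.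
by apply: N_pair; rewrite ?setU11.
Qed.

(** If [A] is empty, delete the vertices one at a time. The link of each vertex is
    covered by [acyclic_above_vertex]: for the singleton of a vertex the bound
    [1 + 3 <= i] is exactly the bound [0 + 4 <= i] at hand. *)
Lemma acyclic_above A B i : #|A|%:Z + 4 <= i -> acyclic R A B U i.
Proof.
move=> le_Ai; have [A0|[x xA]] := set_0Vmem A.
  2: by apply: (acyclic_above_vertex xA); lia.
rewrite {}A0 cards0 in le_Ai *.
have [m] := ubnP #|B|; elim: m B => // m IHm B leBm.
have [B0|[x xB]] := set_0Vmem B.
  apply: acyclic_void => S _; rewrite B0 subset0 => /eqP-> _.
  by rewrite cards0; lia.
apply: (acyclic_split U_upward xB); rewrite ?inE //.
  by apply: (acyclic_above_vertex (setU11 _ _)); rewrite setU0 cards1; lia.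
have ltBm : (#|B :\ x| < m)%N by move: leBm; rewrite (cardsD1 x B) xB.
exact: IHm ltBm.
Qed.
End Induction.

(** * Links of vertices *)

Section LinksOfHypergraph.
Variables (V : finType) (H : {set {set V}}).
Hypothesis H_simple : simple_hypergraph H.
Hypothesis H_link : forall x : V,
  is_graph (hlink H x) /\ chordal (graph_compl (hlink H x)).
Implicit Types (E F W S : {set V}) (u w x y : V).

Lemma imset_trace x E :
  val @: (val @^-1: E : {set {y | y != x}}) = E :\ x.
Proof.
apply/setP => y; apply/imsetP/idP => [[z zE ->]|].
  by move: zE; rewrite !inE (valP z).
by rewrite !inE => /andP[yx yE]; exists (Sub y yx); rewrite ?inE SubK.
Qed.

Lemma card_trace x E :
  #|(val @^-1: E : {set {y | y != x}})| = #|E :\ x|.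
Proof. by rewrite -imset_trace card_imset //; apply: val_inj. Qed.

(** Each trace contains a minimal one, which has two elements since the link is a
    graph. *)
Lemma hlink_below x F : F \in H ->
  exists E, [/\ E \in H, E :\ x \subset F, #|E :\ x| = 2
    & (val @^-1: E : {set {y | y != x}}) \in hlink H x].
Proof.
move=> FH; have trF : (val @^-1: F : {set {y | y != x}}) \in traces H x.
  exact: imset_f.
have [A A_min AF] := minset_exists (C := val @^-1: F) (P := mem (traces H x)) trF.
have A_link : A \in hlink H x by rewrite inE.
have /imsetP[E EH defA] := minsetp A_min.
have [/(_ _ A_link) cardA _] := H_link x.
exists E; split=> //; rewrite -?card_trace -?defA //.
rewrite -imset_trace -defA; apply/subsetP => _ /imsetP[z /(subsetP AF) zF ->].
by rewrite inE in zF.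
Qed.

(** By [hlink_below] an edge has two elements besides any given vertex, hence at
    least three; and if [y] is in [F], the edge [E] with [E :\ y \subset F] contains
    [y], has three elements and lies in [F], so it is [F] by simplicity. The
    vertex [x] excludes the empty [V], where the empty set may be an edge. *)
Lemma card_edge x F : F \in H -> #|F| = 3.
Proof.
have card_ge2 y E : E \in H -> (1 < #|E :\ y|)%N.
  move=> EH; have [A [AH AE cardA _]] := hlink_below y EH.
  have : A :\ y \subset E :\ y.
    apply/subsetP => z zA; rewrite inE (subsetP AE z zA) andbT.
    by move: zA; rewrite !inE => /andP[].
  by move/subset_leq_card; rewrite cardA.
move=> FH; have [F0|[y yF]] := set_0Vmem F.
  by have := card_ge2 x _ FH; rewrite F0 set0D cards0.
have [E [EH EF cardE _]] := hlink_below y FH.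
have yE : y \in E.
  apply: contraT => yE; have [E0|[z zE]] := set_0Vmem E.
    by move: cardE; rewrite E0 set0D cards0.
  have := card_ge2 z _ EH; have := cardsD1 y E; have := cardsD1 z E.
  by rewrite (negPf yE) zE cardE; lia.
have <- : E = F.
  apply: H_simple => //; apply/subsetP => z zE.
  by have [->//|zy] := eqVneq z y; apply: (subsetP EF); rewrite !inE zy.
by rewrite (cardsD1 y) yE cardE.
Qed.

Definition triple x u w := [set x; u; w] \in H.

Lemma tripleC x u w : triple x u w = triple x w u.
Proof. by rewrite /triple setUAC. Qed.

Lemma triple_neq x u w : triple x u w -> [/\ x != u, x != w & u != w].
Proof.
move/(card_edge x); rewrite -setUA cardsU1 !inE cards2.
by do 3?case: eqP => //=.
Qed.

Lemma edge_triple x E : E \in H -> #|E :\ x| = 2 ->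
  exists u w, [/\ u \in E :\ x, w \in E :\ x & triple x u w].
Proof.
move=> EH cardEx; have /eqP/cards2P[u [w [uw defEx]]] := cardEx.
exists u, w; rewrite defEx !inE !eqxx orbT; split=> //.
rewrite /triple -setUA -defEx setD1K //.
by have := card_edge x EH; rewrite (cardsD1 x) cardEx; case: (x \in E).
Qed.

(** For an edge [F] inside [S] that avoids [x], the link of [x] being a graph
    provides an edge through [x] whose other two vertices lie in [F]. *)
Lemma contains_edge_triple x S : x \in S ->
  [exists F in H, F \subset S] = [exists u in S, exists w in S, triple x u w].
Proof.
move=> xS; apply/exists_inP/exists_inP => [[F FH FS]|].
  have [E [EH EF cardE _]] := hlink_below x FH.
  have [u [w [uE wE xuw]]] := edge_triple EH cardE.
  have ES := subset_trans EF FS.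
  exists u; first exact: (subsetP ES).
  by apply/exists_inP; exists w; first exact: (subsetP ES).
move=> [u uS /exists_inP[w wS xuw]]; exists [set x; u; w] => //.
by apply/subsetP => z; rewrite !inE => /orP[/orP[]|] /eqP->.
Qed.

Lemma hlink_triple x (u w : {y | y != x}) : u != w ->
  ([set u; w] \in hlink H x) = triple x (val u) (val w).
Proof.
move=> uw; have uwx : val @: [set u; w] = [set val u; val w].
  by rewrite imsetU1 imset_set1.
apply/idP/idP => [uw_link|xuw].
  have /imsetP[E EH defuw] := minsetp (etrans (esym (in_set _ _)) uw_link).
  rewrite /triple -setUA -uwx defuw imset_trace setD1K //.
  have := card_edge x EH; rewrite (cardsD1 x) -imset_trace -defuw uwx.
  by rewrite cards2 (inj_eq val_inj) uw; case: (x \in E).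
have [E [EH EF cardE E_link]] := hlink_below x xuw.
suff <- : (val @^-1: E : {set {y | y != x}}) = [set u; w] by [].
apply/eqP; rewrite eqEcard card_trace cardE cards2 uw andbT.
apply/subsetP => z; rewrite inE => zE.
have: val z \in E :\ x by rewrite !inE (valP z).
by move/(subsetP EF); rewrite !inE (negPf (valP z)) /= !(inj_eq val_inj).
Qed.

Lemma triple_simplicial x W z : x \notin W -> z \in W ->
  exists2 y, y \in W & {in W &, forall u w,
    triple x u w -> triple x y u || triple x y w}.
Proof.
move=> xW zW; have [_ G_chordal] := H_link x.
have neqx v : v \in W -> v != x by apply: contraTneq => ->.
have G_graph : is_graph (graph_compl (hlink H x)).
  by move=> F; rewrite inE => /andP[/eqP].
pose sub v (vW : v \in W) : {y | y != x} := Sub v (neqx v vW).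
have zW' : sub z zW \in (val @^-1: W : {set {y | y != x}}) by rewrite inE.
have [y yW y_simp] := exists_simplicial G_graph G_chordal zW'.
have adjE (u w : {y | y != x}) :
    adj (graph_compl (hlink H x)) u w = (u != w) && ~~ triple x (val u) (val w).
  rewrite /adj /= in_set cards2; have [//|uw] := boolP (u == w).
  by rewrite hlink_triple.
exists (val y) => [|u w uW wW xuw]; first by rewrite inE in yW.
have [_ _ uw] := triple_neq xuw.
have [yu|yu] := eqVneq y (sub u uW); first by rewrite yu /= xuw orbT.
have [yw|yw] := eqVneq y (sub w wW); first by rewrite yw /= tripleC xuw.
apply: contraT; rewrite negb_or => /andP[nyu nyw].
have := y_simp (sub u uW) (sub w wW); rewrite !adjE yu yw !inE /= uW wW nyu nyw.
by rewrite -val_eqE /= uw xuw => /(_ isT isT isT isT isT).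
Qed.

End LinksOfHypergraph.

(** * Laurent exponents in localizations of the edge ideal *)

Section MonomialIdeal.
Variables (k : fieldType) (V : finType) (H : {set {set V}}).
Local Notation n := #|V|.
Local Notation Frac := {fraction {mpoly k[n]}}.
Local Open Scope ring_scope.
Implicit Types (S T : {set 'I_n}) (m : 'X_{1..n}) (f g : {mpoly k[n]}) (i j : int).

Definition contains_edge S := [exists F in H, enum_rank @: F \subset S].

Lemma contains_edge_upward : upward_closed contains_edge.
Proof.
move=> S T ST /exists_inP[F FH FS]; apply/exists_inP; exists F => //.
exact: subset_trans ST.
Qed.

Definition expo S : 'X_{1..n} := [multinom nat_of_bool (a \in S) | a < n].

Lemma expoE S a : expo S a = (a \in S). Proof. by rewrite mnmE. Qed.

Lemma mdeg_expo S : mdeg (expo S) = #|S|.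
Proof.
rewrite mdegE -sum1_card [RHS]big_mkcond /=; apply: eq_bigr => a _.
by rewrite expoE; case: (a \in S).
Qed.

Lemma prod_expo S : \prod_(a in S) 'X_a = 'X_[expo S] :> {mpoly k[n]}.
Proof.
rewrite mpolyXE_id big_mkcond /=; apply: eq_bigr => a _.
by rewrite expoE; case: (a \in S); rewrite ?expr1 ?expr0.
Qed.

Lemma edge_monomialE F : edge_monomial k F = 'X_[expo (enum_rank @: F)].
Proof.
by rewrite -prod_expo /edge_monomial big_imset //= => x y _ _; apply: enum_rank_inj.
Qed.

Lemma mem_msuppMX f m m' :
  (m' \in msupp (f * 'X_[m])) -> exists2 m0, m0 \in msupp f & m' = (m + m0)%MM.
Proof. by rewrite (perm_mem (msuppMX f m)) => /mapP. Qed.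

(** As the generators are monomials, membership can be tested on each monomial. *)
Lemma edge_idealP f : edge_ideal H f <->
  forall m, m \in msupp f -> contains_edge [set a | (0 < m a)%N].
Proof.
split=> [[c ->] m|supp_f].
  rewrite mcoeff_msupp raddf_sum => neq0.
  have [F /andP[FH]] : exists F, (F \in H) && ((c F * edge_monomial k F)@_m != 0).
    apply/existsP; apply: contraR neq0 => /existsPn c0.
    rewrite big1 // => F FH; have := c0 F; rewrite FH /= negbK.
    by move/eqP.
  rewrite -mcoeff_msupp edge_monomialE => /mem_msuppMX[m0 _ ->].
  apply/exists_inP; exists F => //; apply/subsetP => a aF.
  by rewrite inE mnmDE expoE aF.
rewrite /edge_ideal {1}(mpolyE f).
  have: {subset msupp f <= msupp f} by [].
  elim: {1 3}(msupp f) => [_|m s IHs sub_s].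
    by exists (fun=> 0); rewrite big_nil big1 // => F _; rewrite mul0r.
  have [c defc] := IHs (fun m' ms => sub_s m' (mem_behead (s := m :: s) ms)).
  have /exists_inP[F FH Fm] := supp_f m (sub_s m (mem_head _ _)).
  exists (fun E => c E + if E == F
    then f@_m *: 'X_[m - expo (enum_rank @: F)] else 0).
  rewrite big_cons defc; under [RHS]eq_bigr => E _ do rewrite mulrDl.
  rewrite big_split addrC /=; congr (_ + _).
  rewrite (bigD1 F) //= eqxx big1 ?addr0 => [|E /andP[_ /negPf->]].
  2: by rewrite mul0r.
  rewrite edge_monomialE -scalerAl -mpolyXD submK //; apply/mnm_lepP => a.
  by rewrite expoE; case: (boolP (a \in _)) => // /(subsetP Fm); rewrite inE.
Qed.

Definition low (t : nat) m : {set 'I_n} := [set a | (m a < t)%N].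
Definition high (t : nat) m : {set 'I_n} := [set a | (t < m a)%N].

(** The multidegrees that occur in the localization at [S] in degree [j], for
    fractions with common denominator the [t]-th power of the product of all
    variables: the exponent [m] of the numerator stands for the Laurent exponent
    [m - t], whose negative entries must be at elements of [S], and whose positive
    entries together with [S] must contain an edge. *)
Definition admissible j (t : nat) S m :=
  [&& (mdeg m)%:Z == j + (t * n)%:Z, low t m \subset S
    & contains_edge (S :|: high t m)].

Local Notation full_product t := (tofrac 'X_[expo setT *+ t] : Frac).

Lemma tofrac_monomial_neq0 m : tofrac ('X_[m] : {mpoly k[n]}) != 0.
Proof. rewrite tofrac_eq0; apply/eqP => /(congr1 (mcoeff m))/eqP.
by rewrite mcoeffX eqxx mcoeff0 oner_eq0. Qed.

Lemma loc_deg_clear S j u : loc_deg (edge_ideal (k := k) H) S j u ->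
  exists t0 : nat, forall t, (t0 <= t)%N -> exists g,
    u = tofrac g / full_product t /\ {in msupp g, forall m, admissible j t S m}.
Proof.
move=> [f [t0 [/edge_idealP f_edge f_hom ->]]]; exists t0 => t le_t0t.
pose e := [multinom if a \in S then (t - t0)%N else t | a < n].
have eE a : e a = if a \in S then (t - t0)%N else t by rewrite mnmE.
have e_sum : (e + expo S *+ t0 = expo setT *+ t)%MM.
  apply/mnmP => a; rewrite mnmDE !mulmnE !expoE eE inE.
  by case: (a \in S); rewrite ?mul1n ?mul0n ?subnK ?addn0.
exists (f * 'X_[e]); split.
  rewrite prod_expo -tofracXn mpolyXn -e_sum mpolyXD !tofracM.
  by rewrite (mulrC (tofrac 'X_[e])) -mulf_div divff ?mulr1 ?tofrac_monomial_neq0.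
move=> _ /mem_msuppMX[m mf ->]; apply/and3P; split.
- have /(congr1 (@mdeg n)) := e_sum; rewrite !mdegD !mdegMn !mdeg_expo.
  by rewrite cardsT card_ord; have := f_hom m mf; lia.
- apply/subsetP => a; rewrite inE mnmDE eE; case: ifP => // _; lia.
have /exists_inP[F FH Fm] := f_edge m mf; apply/exists_inP; exists F => //.
apply/subsetP => a /(subsetP Fm); rewrite !inE mnmDE eE; case: ifP => //= _; lia.
Qed.

(** Dividing [g] by its common factor, a power of the variables outside [S],
    leaves the [t]-th power of the product over [S] as denominator; one more factor
    in numerator and denominator makes all variables of [S] divide the numerator,
    which puts it in the edge ideal. *)
Lemma loc_deg_admissible S j (t : nat) g :
  {in msupp g, forall m, admissible j t S m} ->
  loc_deg (edge_ideal (k := k) H) S j (tofrac g / full_product t).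
Proof.
move=> g_adm; pose e := (expo (~: S) *+ t)%MM.
pose f := \sum_(m <- msupp g) g@_m *: 'X_[m + expo S - e] : {mpoly k[n]}.
have fe : f * 'X_[e] = g * 'X_[expo S].
  rewrite [in RHS](mpolyE g) !mulr_suml !big_seq; apply: eq_bigr => m /g_adm.
  move=> /and3P[_ m_low _]; rewrite -!scalerAl -!mpolyXD submK //.
  apply/mnm_lepP => a; rewrite mnmDE mulmnE !expoE inE.
  have [aS|aS] := boolP (a \in S); first by [].
  rewrite mul1n addn0 leqNgt; apply: contra aS => lt_at.
  by apply: (subsetP m_low); rewrite inE.
have f_supp m : m \in msupp f ->
    exists2 m', m' \in msupp g & (m + e = m' + expo S)%MM.
  move=> mf; have: (m + e)%MM \in msupp (f * 'X_[e]).
    by rewrite mcoeff_msupp addmC mcoeffMX -mcoeff_msupp.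
  by rewrite fe => /mem_msuppMX[m' m'g ->]; exists m'; rewrite // addmC.
exists f, t.+1; split.
- apply/edge_idealP => m /f_supp[m' /g_adm/and3P[_ _ /exists_inP[F FH FSm']] def_m].
  apply/exists_inP; exists F => //; apply/subsetP => a /(subsetP FSm').
  move/mnmP/(_ a): def_m; rewrite !inE !mnmDE mulmnE !expoE inE.
  by case: (a \in S) => /=; lia.
- move=> m /f_supp[m' /g_adm/and3P[/eqP m'_deg _ _] /(congr1 (@mdeg n))].
  rewrite !mdegD mdegMn !mdeg_expo; have := cardsC S; rewrite card_ord.
  by move: m'_deg; nia.
have XS_neq0 := tofrac_monomial_neq0; rewrite prod_expo -tofracXn mpolyXn.
apply/eqP; rewrite eqr_div ?XS_neq0 // -!tofracM; apply/eqP; congr tofrac.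
have -> : (expo S *+ t.+1 = expo S + expo S *+ t)%MM.
  by apply/mnmP => a; rewrite mnmDE !mulmnE mulnS.
have -> : (expo setT *+ t = e + expo S *+ t)%MM.
  apply/mnmP => a; rewrite mnmDE !mulmnE !expoE !inE.
  by case: (a \in S); rewrite /= ?mul0n ?addn0 ?add0n.
by rewrite !mpolyXD !mulrA fe.
Qed.

End MonomialIdeal.

(** * Vanishing of local cohomology *)

Section Vanishing.
Variables (k : fieldType) (V : finType) (H : {set {set V}}).
Hypothesis H_simple : simple_hypergraph H.
Hypothesis H_link : forall x : V,
  is_graph (hlink H x) /\ chordal (graph_compl (hlink H x)).
Local Open Scope ring_scope.
Local Notation n := #|V|.
Local Notation Frac := {fraction {mpoly k[n]}}.
Implicit Types (A B S T : {set 'I_n}) (m : 'X_{1..n}) (i j : int) (t : nat).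
Local Notation I := (edge_ideal (k := k) H).

Definition triple_ord (x u w : 'I_n) :=
  triple H (enum_val x) (enum_val u) (enum_val w).

Lemma mem_enum_val (x : 'I_n) S : (enum_val x \in enum_val @: S) = (x \in S).
Proof. exact/mem_imset/enum_val_inj. Qed.

Lemma acyclic_contains_edge A B i :
  #|A|%:Z + 4 <= i -> acyclic k A B (contains_edge H) i.
Proof.
apply: (@acyclic_above _ _ _ triple_ord) => [|x S xS|x W z xW zW|x u w].
- exact: contains_edge_upward.
- have imF (F : {set V}) : (enum_rank @: F \subset S) = (F \subset enum_val @: S).
    apply/subsetP/subsetP => FS a aF.
      by rewrite -(enum_rankK a) mem_enum_val FS ?imset_f.
    by case/imsetP: aF => b bF ->; rewrite -mem_enum_val enum_rankK FS.
  rewrite /contains_edge; under eq_existsb => F do rewrite imF.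
  rewrite (contains_edge_triple H_simple H_link (x := enum_val x)) ?mem_enum_val //.
  apply/exists_inP/exists_inP.
    move=> [_ /imsetP[u uS ->] /exists_inP[_ /imsetP[w wS ->] xuw]].
    by exists u => //; apply/exists_inP; exists w.
  move=> [u uS /exists_inP[w wS xuw]]; exists (enum_val u).
    by rewrite mem_enum_val.
  by apply/exists_inP; exists (enum_val w); rewrite ?mem_enum_val.
- have [||_ /imsetP[y yW ->] y_simp] :=
    triple_simplicial H_simple H_link (x := enum_val x)
      (W := enum_val @: W) (z := enum_val z).
  + by rewrite mem_enum_val.
  + by rewrite mem_enum_val.
  by exists y => // u w uW wW; apply: y_simp; rewrite mem_enum_val.
- exact: tripleC.
Qed.

(** The degree [m] strand of the Cech complex. If [m] has an entry above [t], that
    element can be added and removed freely. Otherwise the degree of [m] gives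
    [j <= - #|low t m|], so [4 <= i + j] implies the bound of
    [acyclic_contains_edge]. *)
Lemma acyclic_admissible i j t m : 4 <= i + j -> (mdeg m)%:Z = j + (t * n)%:Z ->
  acyclic k (low t m) setT (fun S => contains_edge H (S :|: high t m)) i.
Proof.
move=> le4 deg_m; have [high0|[a a_high]] := set_0Vmem (high t m); last first.
  apply: (@acyclic_cone _ _ _ _ _ _ a); rewrite ?inE //.
    by rewrite inE in a_high; rewrite -leqNgt ltnW.
  move=> S _ _; rewrite (setUC [set a]) -setUA.
  rewrite (_ : [set a] :|: _ = high t m) //.
  by apply/setUidPr; rewrite sub1set.
have -> : (fun S => contains_edge H (S :|: high t m)) = contains_edge H.
  by apply: boolp.funext => S; rewrite high0 setU0.
apply: acyclic_contains_edge.
suff : (mdeg m + #|low t m| <= t * n)%N by lia.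
rewrite mdegE -sum1_card [X in (_ + X)%N]big_mkcond -big_split /=.
have -> : (t * n = \sum_(a < n) t)%N by rewrite sum_nat_const card_ord mulnC.
apply: leq_sum => a _.
have : a \notin high t m by rewrite high0 inE.
by rewrite !inE -leqNgt; case: ifP; rewrite ?addn1 ?addn0.
Qed.

(** After clearing denominators by one power of the product of all variables, the
    cocycle splits into one scalar cocycle for each exponent; the strands are
    acyclic, and the scalar solutions are reassembled over the finitely many
    exponents that occur. *)
Lemma cech_coboundary i j (c : {set 'I_n} -> Frac) :
    4 <= i + j -> cech_cochain I i j c -> (forall T, cech_diff c T = 0) ->
  exists b, cech_cochain I (i - 1) j b /\ forall T, cech_diff b T = c T.
Proof.
move=> le4 c_coch c_cocycle.
have cleared S : exists t0 : nat, forall t, (t0 <= t)%N -> exists g,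
    c S = tofrac g / tofrac 'X_[expo setT *+ t]
    /\ {in msupp g, forall m, (#|S|%:Z == i) && admissible H j t S m}.
  have := c_coch S; case: eqP => [_ /loc_deg_clear[t0 ct0]|_ ->].
    by exists t0 => t /ct0.
  exists 0%N => t _; exists 0; rewrite tofrac0 mul0r.
  by split=> // m; rewrite msupp0.
have [t0 ct0] := fin_all_exists cleared.
pose t := (\max_S t0 S)%N; pose X : Frac := tofrac 'X_[expo setT *+ t].
have X_neq0 : X != 0 by apply: tofrac_monomial_neq0.
have [g gP] := fin_all_exists (fun S => ct0 S t (leq_bigmax S)).
have cechE (d : {set 'I_n} -> {mpoly k[n]}) T :
    cech_diff (fun S => tofrac (d S) / X) T = tofrac (coboundary d T) / X.
  rewrite /cech_diff /coboundary raddf_sum mulr_suml; apply: eq_bigr => a _.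
  by rewrite /= tofracM mulrA; congr (_ * _ / _); rewrite tofracXn tofracN tofrac1.
have g_cocycle T : coboundary g T = 0.
  have: tofrac (coboundary g T) / X == 0.
    rewrite -cechE -[X in _ == X](c_cocycle T); apply/eqP/eq_bigr => a _.
    by rewrite -(gP _).1.
  by rewrite mulf_eq0 invr_eq0 (negPf X_neq0) orbF tofrac_eq0 => /eqP.
have coeff_coboundary (d : {set 'I_n} -> {mpoly k[n]}) m T :
    (coboundary d T)@_m = coboundary (fun S => (d S)@_m) T.
  rewrite /coboundary raddf_sum; apply: eq_bigr => a _ /=.
  rewrite -[in LHS]signr_odd -[in RHS]signr_odd.
  by case: odd; rewrite ?expr1 ?expr0 ?mulN1r ?mul1r ?mcoeffN.
have exb m : exists b : {set 'I_n} -> k,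
    (forall S, b S != 0 -> (#|S|%:Z == i - 1) && admissible H j t S m)
    /\ forall T, coboundary b T = (g T)@_m.
  have g_supp S : (g S)@_m != 0 -> (#|S|%:Z == i) && admissible H j t S m.
    by rewrite -mcoeff_msupp => /(gP S).2.
  have [/eqP deg_m|deg_m] := boolP ((mdeg m)%:Z == j + (t * n)%:Z); last first.
    exists (fun=> 0); split=> [S|T]; first by rewrite eqxx.
    rewrite coboundary_eq0 //; apply/esym/eqP; apply: contraR deg_m => /g_supp.
    by move=> /and4P[].
  have [||b b_supp db] := acyclic_admissible le4 deg_m (c := fun S => (g S)@_m).
  - by move=> S /g_supp/and4P[/eqP cardS _ lowS edgeS]; split.
  - by move=> T _; rewrite -coeff_coboundary g_cocycle mcoeff0.
  exists b; split=> [S /b_supp[lowS _ edgeS cardS]|T]; last exact: db.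
  by rewrite cardS eqxx /admissible deg_m eqxx lowS.
have [b bP] := boolp.choice exb.
pose L := undup (flatten (codom (fun D => msupp (g D) : seq _))).
pose h S : {mpoly k[n]} := \sum_(m <- L) b m S *: 'X_[m].
have hE S m : (h S)@_m = if m \in L then b m S else 0.
  rewrite raddf_sum; case: ifP => mL /=.
    rewrite (bigD1_seq m) ?undup_uniq //= mcoeffZ mcoeffX eqxx mulr1 big1 ?addr0 //.
    by move=> m' /negPf m'm; rewrite mcoeffZ mcoeffX m'm mulr0.
  rewrite big_seq big1 // => m' m'L; rewrite mcoeffZ mcoeffX.
  by case: eqP m'L => [->|_ _]; rewrite ?mL ?mulr0.
have h_supp S m : m \in msupp (h S) -> (#|S|%:Z == i - 1) && admissible H j t S m.
  rewrite mcoeff_msupp hE; case: ifP => _; first exact: (bP m).1.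
  by rewrite eqxx.
have dh T : coboundary h T = g T.
  apply/mpolyP => m; rewrite coeff_coboundary; have [mL|mL] := boolP (m \in L).
    by rewrite -(bP m).2; apply: eq_coboundary => a _; rewrite hE mL.
  rewrite coboundary_eq0 => [|S]; last by rewrite hE (negPf mL).
  apply/esym/eqP; rewrite mcoeff_eq0; apply: contra mL => mg.
  rewrite mem_undup; apply/flattenP; exists (msupp (g T)) => //.
  exact: codom_f (fun D => msupp (g D) : seq _) T.
exists (fun S => tofrac (h S) / X).
split=> [S|T]; last by rewrite cechE dh (gP T).1.
case: ifP => cardS; first by apply: loc_deg_admissible => m /h_supp/andP[].
suff -> : h S = 0 by rewrite tofrac0 mul0r.
apply/eqP; rewrite -msupp_eq0; case: (msupp _) (@h_supp S) => // m s /(_ m).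
by rewrite mem_head cardS => /(_ isT).
Qed.

End Vanishing.

Unset Implicit Arguments.
Set Strict Implicit.
Set Printing Implicit Defensive.

Theorem theorem6p4 (k : fieldType) (V : finType) (H : {set {set V}})
    (Hsimple : simple_hypergraph H)
    (Hisolated : forall x : V, ~ isolated H x)
    (Hlink : forall x : V,
       is_graph (hlink H x) /\ chordal (graph_compl (hlink H x))) :
  (hreg k H <= 3%:E)%E.
Proof.
(* The value is an honest supremum if there is one, and -oo otherwise. *)
rewrite /hreg /reg /classical_sets.supremum; case: ifP => _; first exact: leNye.
case: classical_sets.xgetP => [_ -> [_ sup_min]|_]; last exact: leNye.
apply: sup_min => _ [i [j [[c [c_coch c_cocycle c_not_cob]] ->]]].
rewrite lee_fin leNgt; apply/negP => gt3; apply: c_not_cob.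
by apply: cech_coboundary c_coch c_cocycle => //; lia.
Qed.
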